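(* Let $r,s,t$ be non-negative integers (which may depend on $n$) with $r+t=o(\sqrt{\log n})$ and $1\le s=n^{o(1)}$ for $n\in\mathbb{N}$. Then $$R(S_{r,s,t},Q_n)\le n+\frac{\big(1+o(1)\big)(r+t)n}{\log n}.$$
   Context: $\mathbb{N}$ is the set of positive integers and $\log$ is the logarithm to base $2$. All asymptotic notation depends exclusively on $n$: $f(n)=o(g(n))$ if and only if $f(n)/g(n)\to0$ as $n\to\infty$, and $s=n^{o(1)}$ means $\log s/\log n\to 0$ as $n\to\infty$. For $n\in\mathbb{N}$, the Boolean lattice $Q_n$ of dimension $n$ is the poset of all subsets of an $n$-element ground set ordered by inclusion. A poset $P_1$ is an induced subposet of a poset $P_2$ if $P_1\subseteq P_2$ and for all $X,Y\in P_1$, $X\le_{P_1}Y$ if and only if $X\le_{P_2}Y$. A copy of $P_1$ in $P_2$ is an induced subposet of $P_2$ isomorphic to $P_1$. A blue/red coloring of a poset $P$ is a map $P\to\{\text{blue},\text{red}\}$ coloring its elements; a copy is blue (red) if all its elements are blue (red). The poset Ramsey number $R(P,Q)$ is the smallest $N\in\mathbb{N}$ such that every blue/red coloring of $Q_N$ contains a blue copy of $P$ or a red copy of $Q$. For integers $r\ge0$, $s\ge1$, $t\ge0$, the $(r,s,t)$-spindle $S_{r,s,t}$ is the poset on $r+s+t$ elements formed by the disjoint union of an antichain $A$ of size $s$, a chain $C_r$ on $r$ elements and a chain $C_t$ on $t$ elements, such that every element of $C_r$ is smaller than every element of $A$ and of $C_t$, and every element of $A$ is smaller than every element of $C_t$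.
   Formalization: The bound is asserted for n ≥ 2 (log 1 = 0), and where r = t = 0 only for s = 1: for r = t = 0, s ≥ 2 the stated bound is n, which is false, since coloring one element of Q_n blue and the rest red shows R ≥ n+1. *)

(* Defs.v *)
From HB Require Import structures.
From mathcomp Require Import all_boot all_order all_algebra.
From mathcomp Require Import all_classical all_reals all_analysis.

Set Implicit Arguments.
Unset Strict Implicit.
Unset Printing Implicit Defensive.

Import Order.TTheory GRing.Theory Num.Theory.

Local Open Scope order_scope.

Definition boolean_lattice (n : nat) : Type := {set 'I_n}.

HB.instance Definition _ n := Finite.on (boolean_lattice n).

Lemma boolean_lattice_anti n :
  antisymmetric (fun A B : boolean_lattice n => A \subset B).
Proof. by move=> A B ABA; apply/setP/subset_eqP. Qed.

HB.instance Definition _ n :=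
  Order.Le_isPOrder.Build Order.SetSubsetOrder.subset_display
    (boolean_lattice n) (fun A : {set 'I_n} => fintype.subxx A)
    (@boolean_lattice_anti n)
    (fun B A C : {set 'I_n} => @fintype.subset_trans _ A B C).

Lemma boolean_latticeE n (A B : boolean_lattice n) : (A <= B) = (A \subset B).
Proof. by []. Qed.

Inductive color := blue | red.

Definition is_copy d d' (P : finPOrderType d) (L : finPOrderType d')
    (S : {set L}) : Prop :=
  exists2 f : P -> L, {mono f : x y / x <= y} & S = [set f x | x : P].

Arguments is_copy {d d'} P {L} S.

Definition has_monochromatic_copy d d' (P : finPOrderType d)
    (L : finPOrderType d') (c : L -> color) (k : color) : Prop :=
  exists2 S : {set L}, is_copy P S & {in S, forall X, c X = k}.

Arguments has_monochromatic_copy {d d'} P {L} c k.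

Definition ramsey_for d d' (P : finPOrderType d) (Q : finPOrderType d')
    (N : nat) : Prop :=
  forall c : boolean_lattice N -> color,
    has_monochromatic_copy P c blue \/ has_monochromatic_copy Q c red.

(* The graph of the poset Ramsey number, R(P, Q) = N; being a relation, it
   needs no default value should no N satisfy [ramsey_for P Q N]. *)
Definition is_poset_ramsey d d' (P : finPOrderType d) (Q : finPOrderType d')
    (N : nat) : Prop :=
  [/\ (0 < N)%N, ramsey_for P Q N &
      forall M : nat, (0 < M)%N -> ramsey_for P Q M -> (N <= M)%N].

(* [inl (inl i)] ranges over the lower chain C_r, [inl (inr i)] over the
   antichain A and [inr i] over the upper chain C_t. *)
Definition spindle (r s t : nat) : Type := ('I_r + 'I_s + 'I_t)%type.

HB.instance Definition _ r s t := Finite.on (spindle r s t).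

Definition spindle_le r s t (x y : spindle r s t) : bool :=
  match x, y with
  | inl (inl i), inl (inl j) => (i <= j)%N
  | inl (inl _), inl (inr _) => true
  | inl (inl _), inr _ => true
  | inl (inr i), inl (inr j) => i == j
  | inl (inr _), inr _ => true
  | inr i, inr j => (i <= j)%N
  | _, _ => false
  end.

Lemma spindle_le_refl r s t : reflexive (@spindle_le r s t).
Proof. by case=> [[i|i]|i] /=; rewrite ?leqnn ?eqxx. Qed.

Lemma spindle_le_anti r s t : antisymmetric (@spindle_le r s t).
Proof.
case=> [[i|i]|i] [[j|j]|j] //=.
- by rewrite -eqn_leq => /eqP /val_inj ->.
- by case/andP => /eqP ->.
- by rewrite -eqn_leq => /eqP /val_inj ->.
Qed.

Lemma spindle_le_trans r s t : transitive (@spindle_le r s t).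
Proof.
case=> [[j|j]|j] [[i|i]|i] [[k|k]|k] //=; try exact: leq_trans.
by move/eqP->.
Qed.

Fact spindle_display : Order.disp_t. Proof. exact: Order.Disp tt tt. Qed.

HB.instance Definition _ r s t :=
  Order.Le_isPOrder.Build spindle_display (spindle r s t)
    (@spindle_le_refl r s t) (@spindle_le_anti r s t) (@spindle_le_trans r s t).

Definition log2 (R : realType) (x : R) : R := (ln x / ln 2)%R.

(* Main.v *)
Require Import Defs.
From HB Require Import structures.
From mathcomp Require Import all_boot all_order all_algebra all_fingroup.
From mathcomp Require Import all_classical all_reals all_analysis.
From mathcomp Require Import zify ring lra.

Import Order.TTheory GRing.Theory Num.Theory.
Import numFieldNormedType.Exports.

(** The bound is a pigeonhole argument on blue chains.  Write m = r + t and
    split the ground set of a Boolean lattice of dimension n + k into a set of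
    n elements and a set Y of k elements.

    Suppose that a coloring has no red copy of Q_n.  Then every ordering of Y
    comes with a blue chain Z_0, ..., Z_k such that Z_i meets Y in the first i
    elements of that ordering ([blue_chain_of_no_red_lattice]): otherwise one
    could assign to each subset X of the other n elements, monotonically in X,
    an initial segment of Y whose union with X is red, which is a red copy of
    Q_n.  This gives k! chains, one for each ordering.

    Group the orderings by the r lowest and the t highest members of their
    chains.  These m sets are nested, so they are determined by how many of
    them miss each of the n + k points, and there are at most (m + 1)^(n + k)
    groups.  Inside one group, two middle members Z_i of different chains with
    different traces on Y are incomparable, because the traces have the same
    size i.  Hence s different traces at one middle level i yield a blue
    spindle: the s sets form the antichain, and the common lowest and highest
    members form the chains below and above it.  With no blue spindle, each
    level of each group has at most s traces, and since an ordering is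
    determined by its initial segments, a group has at most s^k orderings.
    Therefore (m + 1)^(n + k) * s^k < k! implies R(S_{r,s,t}, Q_n) <= n + k
    ([ramsey_for_spindle]).

    It remains to choose k.  As k^k <= 4^k * k! and m + 1 <= 2^m, it is enough
    that m * n < k * (log k - m - log s - 2) ([lt_factorial_of_log2]).  Under
    the asymptotic hypotheses m, log s and log log n are all o(log n), so the
    bracket is (1 - o(1)) * log n as soon as k >= n / log n, and
    k = (1 + e) * m * n / log n works for every fixed e > 0 and all large n
    ([eventually_factorial_bound]).  If m = 0 then s = 1, the spindle is a
    single point, and dimension n is enough. *)

Lemma monochromatic_copy_of_mono {d d'} {P : finPOrderType d}
    {L : finPOrderType d'} {c : L -> color} {k : color} (f : P -> L) :
  {mono f : x y / (x <= y)%O} -> (forall x, c (f x) = k) ->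
  has_monochromatic_copy P c k.
Proof.
move=> f_mono f_k; exists [set f x | x : P]; first by exists f.
by move=> _ /imsetP[x _ ->].
Qed.

(** * Sets of two kinds of points, and initial segments of an ordering *)

Lemma card_ord_lt N i : #|[set j : 'I_N | j < i]%N| = minn i N.
Proof.
have [le_iN|lt_Ni] := leqP i N.
  by rewrite cardsE -sum1_card (big_ord_narrow le_iN) sum1_card card_ord.
rewrite cardsE -[RHS]card_ord; apply: eq_card => j.
by rewrite !inE; exact: ltn_trans (ltn_ord j) lt_Ni.
Qed.

Section Gluing.
Context {n k : nat}.

Definition glue_sets (X : {set 'I_n}) (Y : {set 'I_k}) :
    boolean_lattice (n + k) :=
  [set i | match fintype.split i with inl x => x \in X | inr y => y \in Y end].

Lemma glue_sets_subset X Y X' Y' :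
  (glue_sets X Y \subset glue_sets X' Y') = (X \subset X') && (Y \subset Y').
Proof.
apply/fintype.subsetP/andP => [sub |
    [/fintype.subsetP sX /fintype.subsetP sY] i].
  split; apply/fintype.subsetP => x x_in.
    have := sub (lshift k x); rewrite !inE.
    by rewrite -[lshift k x]/(fintype.unsplit (inl x)) unsplitK; apply.
  have := sub (rshift n x); rewrite !inE.
  by rewrite -[rshift n x]/(fintype.unsplit (inr x)) unsplitK; apply.
by rewrite !inE; case: (fintype.split i) => x; [apply: sX | apply: sY].
Qed.

(** An ordering of Y is given by ranks: [sigma y] is the position of [y], so
    this is the set of the first [i] points. *)
Definition prefix (sigma : 'S_k) (i : nat) : {set 'I_k} :=
  [set y | (sigma y < i)%N].

Lemma card_prefix sigma i : (i <= k)%N -> #|prefix sigma i| = i.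
Proof.
move=> le_ik; have -> :
    prefix sigma i = (sigma @^-1: [set j : 'I_k | (j < i)%N]).
  by apply/setP => y; rewrite !inE.
rewrite card_preimset; last exact: perm_inj.
by rewrite card_ord_lt; exact/minn_idPl.
Qed.

Lemma prefix_homo sigma :
  {homo prefix sigma : i j / (i <= j)%N >-> (i \subset j)}.
Proof.
move=> i j le_ij; apply/fintype.subsetP => y; rewrite !inE => lt_yi.
exact: leq_trans le_ij.
Qed.

Lemma prefix_subset_leq {sigma tau i j} : (i <= k)%N -> (j <= k)%N ->
  prefix sigma i \subset prefix tau j -> (i <= j)%N.
Proof. by move=> ik jk /subset_leq_card; rewrite !card_prefix. Qed.

Lemma prefix_subset_eq {sigma tau i} : (i <= k)%N ->
  prefix sigma i \subset prefix tau i -> prefix sigma i = prefix tau i.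
Proof.
by move=> ik sub; apply/eqP; rewrite eqEcard sub !card_prefix /=.
Qed.

Lemma prefix_inj sigma tau :
  (forall i : 'I_k, prefix sigma i.+1 = prefix tau i.+1) -> sigma = tau.
Proof.
move=> eq_pre; apply/permP => y; apply/val_inj/eqP.
rewrite eqn_leq; apply/andP; split.
  by have /setP/(_ y) := eq_pre (tau y); rewrite !inE !ltnS leqnn.
by have /setP/(_ y) := eq_pre (sigma y); rewrite !inE !ltnS leqnn.
Qed.

(** * The blue chain of an ordering *)

Section ChainLemma.
Variables (c : boolean_lattice (n + k) -> color) (Y : nat -> {set 'I_k}).
Hypothesis Y_homo : {homo Y : i j / (i <= j)%N >-> (i \subset j)}.

Let is_blue A := if c A is blue then true else false.

(** Tests for a blue chain of length [j], whose [i]-th member has trace [Y i]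
    on the second kind of points, and whose traces on the first kind are nested
    subsets of [X]. *)
Fixpoint blue_chain_below (j : nat) (X : {set 'I_n}) : bool :=
  if j is i.+1 then
    [exists X' : {set 'I_n},
       [&& X' \subset X, blue_chain_below i X' & is_blue (glue_sets X' (Y i))]]
  else true.

Lemma blue_chain_belowS {j} {X X' : {set 'I_n}} : X \subset X' ->
  blue_chain_below j X -> blue_chain_below j X'.
Proof.
case: j => [//|j] sXX' /= /existsP[W /and3P[sWX bW cW]].
by apply/existsP; exists W; rewrite (fintype.subset_trans sWX sXX') bW.
Qed.

Lemma blue_chain_belowP {j X} : blue_chain_below j X ->
  exists h : nat -> {set 'I_n},
    [/\ {homo h : i i' / (i <= i')%N >-> (i \subset i')},
        forall i, h i \subset X &
        forall i, (i < j)%N -> c (glue_sets (h i) (Y i)) = blue].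
Proof.
elim: j X => [|j IH] X /=.
  by exists (fun=> X); split=> // *; exact: fintype.subxx.
case/existsP=> W /and3P[sWX /IH[h [h_homo hW h_blue]]]; rewrite /is_blue.
case cW: (c _) => // _; exists (fun i => if (i < j)%N then h i else W).
split=> [i i' le_ii' | i | i lt_ij].
- case: ltnP => [lt_ij|le_ji]; case: ltnP => // lt_i'j.
    exact: h_homo.
  by rewrite ltnNge (leq_trans le_ji le_ii') in lt_i'j.
- by case: ifP => // _; apply: fintype.subset_trans (hW i) sWX.
- case: ltnP => [/h_blue//|le_ji].
  by have -> : i = j by apply/eqP; rewrite eqn_leq le_ji -ltnS lt_ij.
Qed.

(** Let [g X] be the length of a longest such chain below [X]; it is monotone
    in [X].  If no chain is complete, then [X] together with [Y (g X)] must be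
    red, for otherwise it would extend the chain; so these sets form a red copy
    of the lattice. *)
Lemma blue_chain_of_no_red_lattice :
  ~ has_monochromatic_copy (boolean_lattice n) c red ->
  exists2 h : nat -> {set 'I_n},
    {homo h : i j / (i <= j)%N >-> (i \subset j)} &
    forall i, (i <= k)%N -> c (glue_sets (h i) (Y i)) = blue.
Proof.
move=> no_red.
have [[X bX]|no_chain] := pselect (exists X, blue_chain_below k.+1 X).
  by have [h [h_homo _ h_blue]] := blue_chain_belowP bX; exists h.
case: no_red.
pose g (X : {set 'I_n}) := (\max_(j < k.+1 | blue_chain_below j X) j)%N.
have g_chain X : blue_chain_below (g X) X.
  rewrite /g; elim/big_ind: _ => // a b.
  by rewrite /maxn; case: ifP.
have g_ge X j : blue_chain_below j X -> (j < k.+1)%N -> (j <= g X)%N.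
  by move=> bj lt_jk; apply: (@leq_bigmax_cond _ _ _ (Ordinal lt_jk)).
have g_le X : (g X < k.+1)%N.
  by rewrite ltnS; apply/bigmax_leqP => j _; rewrite -ltnS ltn_ord.
apply: (@monochromatic_copy_of_mono _ _ (boolean_lattice n) _ _ _
  (fun X : {set 'I_n} => glue_sets X (Y (g X)))) => [X X' | X].
  rewrite !boolean_latticeE glue_sets_subset.
  have [sXX' /=|//] := boolP (X \subset X'); apply: Y_homo.
  exact: g_ge (blue_chain_belowS sXX' (g_chain X)) (g_le X).
case cX: (c _) => //.
have bX : blue_chain_below (g X).+1 X.
  apply/existsP; exists X; apply/and3P; split; first exact: fintype.subxx.
    exact: g_chain.
  by rewrite /is_blue cX.
have := g_le X; rewrite leq_eqVlt => /orP[/eqP gk|lt_g].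
  by case: no_chain; exists X; rewrite -gk.
by have := g_ge X _ bX lt_g; rewrite ltnn.
Qed.

End ChainLemma.

End Gluing.

(** * Counting orderings when there is no blue spindle *)

Section Spindle.
Variables (r s t n k : nat) (c : boolean_lattice (n + k) -> color).
Variable h : 'S_k -> nat -> {set 'I_n}.
Hypothesis h_homo : forall sigma,
  {homo h sigma : i j / (i <= j)%N >-> (i \subset j)}.
Hypothesis h_blue : forall sigma i, (i <= k)%N ->
  c (glue_sets (h sigma i) (prefix sigma i)) = blue.

Let Z sigma i := glue_sets (h sigma i) (prefix sigma i).

Lemma chain_homo sigma {i j} : (i <= j)%N -> Z sigma i \subset Z sigma j.
Proof. by move=> ij; rewrite glue_sets_subset h_homo ?prefix_homo. Qed.

Lemma chain_level_le {sigma tau i j} : (i <= k)%N -> (j <= k)%N ->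
  Z sigma i \subset Z tau j -> (i <= j)%N.
Proof.
by rewrite glue_sets_subset => ik jk /andP[_]; apply: prefix_subset_leq.
Qed.

(** The levels of the [r] lowest and of the [t] highest members of a chain
    with levels 0, ..., k. *)
Definition is_end (j : nat) := (j < r)%N || (k < j + t)%N.

Definition same_ends sigma tau :=
  forall j, (j <= k)%N -> is_end j -> Z sigma j = Z tau j.

(** Traces on Y at the same level have the same size, so distinct ones are
    incomparable; the chains that carry them share the members used for the
    lower and the upper part of the spindle. *)
Lemma blue_spindle_of_same_ends (sigma : 'I_s -> 'S_k) (i : nat) :
    (0 < s)%N -> (i <= k)%N -> ~~ is_end i ->
    (forall a b, same_ends (sigma a) (sigma b)) ->
    injective (fun a => prefix (sigma a) i) ->
  has_monochromatic_copy (spindle r s t) c blue.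
Proof.
rewrite /is_end negb_or -!leqNgt => s_gt0 le_ik /andP[le_ri le_itk] same inj.
pose a0 := Ordinal s_gt0.
pose f (x : spindle r s t) : boolean_lattice (n + k) := match x with
  | inl (inl j) => Z (sigma a0) j
  | inl (inr a) => Z (sigma a) i
  | inr j => Z (sigma a0) (k.+1 - t + j)
  end.
have low (j : 'I_r) : (j < i)%N by apply: leq_trans le_ri.
have lowk (j : 'I_r) : (j <= k)%N by apply: leq_trans le_ik; apply: ltnW.
have up (j : 'I_t) : (i < k.+1 - t + j)%N by lia.
have upk (j : 'I_t) : (k.+1 - t + j <= k)%N by case: j => j /=; lia.
have lowE a (j : 'I_r) : Z (sigma a0) j = Z (sigma a) j.
  by apply: same; rewrite // /is_end ltn_ord.
have upE a (j : 'I_t) :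
    Z (sigma a0) (k.+1 - t + j) = Z (sigma a) (k.+1 - t + j).
  by apply: same; rewrite // /is_end; apply/orP; right; lia.
apply: (monochromatic_copy_of_mono f) => [x y|]; last first.
  by case=> [[j|a]|j] /=; apply: h_blue.
rewrite boolean_latticeE.
apply/idP/idP; case: x y => [[j|a]|j] [[j'|a']|j'] //=.
- exact: chain_level_le.
- by move/(chain_level_le le_ik (lowk j')); rewrite leqNgt low.
- rewrite glue_sets_subset => /andP[_ /(prefix_subset_eq le_ik) /inj ->].
  exact: eqxx.
- move/(chain_level_le (upk j) (lowk j')) => le_jj'.
  by have := up j; have := low j'; lia.
- by move/(chain_level_le (upk j) le_ik) => le_j; have := up j; lia.
- by move/(chain_level_le (upk j) (upk j')); rewrite leq_add2l.
- exact: chain_homo.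
- by move=> _; rewrite (lowE a'); apply/chain_homo/ltnW.
- by move=> _; apply/chain_homo/ltnW/(ltn_trans (low j) (up j')).
- by move/eqP=> ->; exact: fintype.subxx.
- by move=> _; rewrite (upE a); apply/chain_homo/ltnW.
- by move=> le_jj'; apply: chain_homo; rewrite leq_add2l.
Qed.

(** At an end level the chains of [K] agree, so there is at most one prefix;
    at a middle level, [s] distinct prefixes would give a blue spindle. *)
Lemma card_prefixes_le (K : {set 'S_k}) (i : nat) : (0 < s)%N -> (i <= k)%N ->
    {in K &, forall sigma tau, same_ends sigma tau} ->
    ~ has_monochromatic_copy (spindle r s t) c blue ->
  (#|[set prefix sigma i | sigma in K]| <= s)%N.
Proof.
move=> s_gt0 le_ik same no_blue; set F := [set _ | _ in _].
have [end_i|mid_i] := boolP (is_end i).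
  apply: leq_trans s_gt0.
  apply/card_le1_eqP => _ _ /imsetP[u uK ->] /imsetP[v vK ->].
  have sub x y : x \in K -> y \in K -> prefix x i \subset prefix y i.
    move=> xK yK; have := fintype.subxx (Z x i).
    by rewrite {2}(same x y xK yK) // glue_sets_subset => /andP[].
  exact: prefix_subset_eq le_ik (sub _ _ _ _).
rewrite leqNgt; apply/negP => lt_sF; case: no_blue.
(* [g] lists s distinct prefixes, and [sigma] orderings that realize them. *)
pose g (a : 'I_s) : {set 'I_k} := enum_val (widen_ord (ltnW lt_sF) a).
have [sigma sigmaP] : exists sigma : 'I_s -> 'S_k,
    forall a, sigma a \in K /\ g a = prefix (sigma a) i.
  apply: (fin_all_exists (P := fun a u => u \in K /\ g a = prefix u i)) => a.
  by have /imsetP[u uK gE] := enum_valP (widen_ord (ltnW lt_sF) a); exists u.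
refine (blue_spindle_of_same_ends sigma i s_gt0 le_ik mid_i _ _) => [a b|a b].
  by apply: same; apply: (sigmaP _).1.
rewrite -!(sigmaP _).2 => /enum_val_inj /(congr1 val) /= ab.
exact/val_inj.
Qed.

(** An ordering is determined by its nonempty prefixes, one for each of [k]
    levels, and every level offers at most [s] choices. *)
Lemma card_same_ends_le (K : {set 'S_k}) : (0 < s)%N ->
    {in K &, forall sigma tau, same_ends sigma tau} ->
    ~ has_monochromatic_copy (spindle r s t) c blue ->
  (#|K| <= s ^ k)%N.
Proof.
move=> s_gt0 same no_blue.
pose F (i : 'I_k) : {set {set 'I_k}} := [set prefix sigma i.+1 | sigma in K].
pose prefixes (sigma : 'S_k) := [ffun i : 'I_k => prefix sigma i.+1].
have prefixes_inj : injective prefixes.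
  by move=> u v /ffunP uv; apply: prefix_inj => i; have := uv i; rewrite !ffunE.
rewrite -(card_imset _ prefixes_inj).
apply: (@leq_trans #|family (fun i => [in F i])|).
  apply/subset_leq_card/fintype.subsetP => _ /imsetP[u uK ->].
  by apply/familyP => i; rewrite ffunE; apply: imset_f.
rewrite card_family foldrE big_map big_enum /=.
rewrite -[k in (s ^ k)%N]card_ord -prod_nat_const.
by apply: leq_prod => i _; apply: card_prefixes_le.
Qed.

Definition ends_missing sigma (x : 'I_(n + k)) : {set 'I_k.+1} :=
  [set j : 'I_k.+1 | is_end j && (x \notin Z sigma j)].

Lemma card_ends_missing sigma x : (#|ends_missing sigma x| <= r + t)%N.
Proof.
pose lo := [set j : 'I_k.+1 | (j < r)%N].
pose up := (@rev_ord k.+1 @^-1: [set j : 'I_k.+1 | (j < t)%N]).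
have sub : ends_missing sigma x \subset lo :|: up.
  apply/fintype.subsetP => j; rewrite !inE /= => /andP[/orP[->//|kj] _].
  by apply/orP; right; have := ltn_ord j; lia.
apply: leq_trans (subset_leq_card sub) _.
rewrite (leq_trans (leq_card_setU _ _)) // leq_add ?card_ord_lt ?geq_minl //.
by rewrite /up (card_preimset _ (@rev_ord_inj _)) card_ord_lt geq_minl.
Qed.

(** The end members of a chain are nested, so those missing [x] are the lowest
    ones, and their number determines which they are. *)
Lemma ends_missing_same sigma tau :
  (forall x, #|ends_missing sigma x| = #|ends_missing tau x|) ->
  same_ends sigma tau.
Proof.
have proper_missing u v x j : (j <= k)%N -> is_end j ->
    x \in Z u j -> x \notin Z v j ->
    (#|ends_missing u x| < #|ends_missing v x|)%N.
  move=> le_jk end_j xu xv; apply: proper_card; apply/properP; split.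
    apply/fintype.subsetP => i; rewrite inE => /andP[end_i xi].
    rewrite inE end_i /=.
    have le_ij : (i <= j)%N.
      rewrite leqNgt; apply/negP => /ltnW /(chain_homo u) /fintype.subsetP.
      by move=> /(_ _ xu) xui; rewrite xui in xi.
    have /fintype.subsetP/(_ x) sub := chain_homo v le_ij.
    exact: contra sub xv.
  have lt_jk : (j < k.+1)%N by [].
  by exists (Ordinal lt_jk); rewrite inE /= end_j ?xv // xu.
move=> eq_card j le_jk end_j; apply/setP => x; apply/idP/idP => x_in.
  apply/negPn/negP => x_out.
  have := proper_missing _ _ _ _ le_jk end_j x_in x_out.
  by rewrite eq_card ltnn.
apply/negPn/negP => x_out.
have := proper_missing _ _ _ _ le_jk end_j x_in x_out.
by rewrite eq_card ltnn.
Qed.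

(** Pigeonhole: the numbers of end members missing each point take at most
    [(r + t).+1 ^ (n + k)] joint values, and orderings with the same numbers
    have the same ends. *)
Lemma factorial_le_of_no_blue_spindle : (0 < s)%N ->
    ~ has_monochromatic_copy (spindle r s t) c blue ->
  (k`! <= (r + t).+1 ^ (n + k) * s ^ k)%N.
Proof.
move=> s_gt0 no_blue.
pose signature (sigma : 'S_k) : {ffun 'I_(n + k) -> 'I_(r + t).+1} :=
  [ffun x => inord #|ends_missing sigma x|].
have -> : ((r + t).+1 ^ (n + k) = #|{ffun 'I_(n + k) -> 'I_(r + t).+1}|)%N.
  by rewrite card_ffun !card_ord.
rewrite -card_Sn -sum1_card (partition_big signature predT) //=.
rewrite -sum_nat_const; apply: leq_sum => kappa _.
rewrite sum1dep_card.
apply: card_same_ends_le => // u v; rewrite !finset.in_set => /eqP uE /eqP vE.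
apply: ends_missing_same => x.
have : signature u x = signature v x by rewrite uE vE.
rewrite !ffunE => /(congr1 (@nat_of_ord _)).
by rewrite !inordK ?ltnS ?card_ends_missing.
Qed.

End Spindle.

Lemma ramsey_for_spindle r s t n k : (0 < s)%N ->
    ((r + t).+1 ^ (n + k) * s ^ k < k`!)%N ->
  ramsey_for (spindle r s t) (boolean_lattice n) (n + k).
Proof.
move=> s_gt0 big_fact c.
have [?|no_red] := pselect (has_monochromatic_copy (boolean_lattice n) c red).
  by right.
have [?|no_blue] := pselect (has_monochromatic_copy (spindle r s t) c blue).
  by left.
have chains sigma :=
  blue_chain_of_no_red_lattice c _ (prefix_homo sigma) no_red.
have [h hP] : exists h : 'S_k -> nat -> {set 'I_n}, forall sigma,
    {homo h sigma : i j / (i <= j)%N >-> (i \subset j)} /\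
    forall i, (i <= k)%N -> c (glue_sets (h sigma i) (prefix sigma i)) = blue.
  apply: (fin_all_exists (P := fun sigma (h : nat -> {set 'I_n}) =>
    {homo h : i j / (i <= j)%N >-> (i \subset j)} /\
    forall i, (i <= k)%N ->
      c (glue_sets (h i) (prefix sigma i)) = blue)) => sigma.
  by have [h h_homo h_blue] := chains sigma; exists h.
have := @factorial_le_of_no_blue_spindle r s t n k c h (fun u => (hP u).1)
  (fun u => (hP u).2) s_gt0 no_blue.
by rewrite leqNgt big_fact.
Qed.

(** * A lower bound for factorials *)

(** Indeed k^k <= (k + 1) * ... * (2 k) = 'C(2 k, k) * k!, and
    'C(2 k, k) <= 2^(2 k). *)
Lemma exp_self_le_factorial k : (k ^ k <= 4 ^ k * k`!)%N.
Proof.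
have ffact_ge m j : (j ^ m <= (j + m) ^_ m)%N.
  elim: m => [|m IH]; first by rewrite ffactn0.
  by rewrite addnS ffactnS expnS leq_mul // leqW // leq_addr.
apply: leq_trans (ffact_ge k k) _.
rewrite -bin_ffact leq_mul2r; apply/orP; right.
rewrite (_ : 4 = 2 ^ 2)%N // -expnM mul2n -addnn.
rewrite -[2%N]/(1 + 1)%N expnDn.
have lt_k : (k < (k + k).+1)%N by rewrite ltnS leq_addr.
by rewrite (bigD1 (Ordinal lt_k)) //= !exp1n !muln1 leq_addr.
Qed.

(** * Existence of the Ramsey number *)

Lemma ramsey_for_point n :
  ramsey_for (spindle 0 1 0) (boolean_lattice n) n.
Proof.
move=> c; have [[A cA]|no_blue] := pselect (exists A, c A = blue).
  left; apply: (monochromatic_copy_of_mono (fun=> A)) => // x y.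
  rewrite lexx; case: x y => [[[]|a]|[]] // [[[]|b]|[]] //.
  by rewrite !ord1.
right; apply: (monochromatic_copy_of_mono id) => // A.
by case cA: (c A) => //; case: no_blue; exists A.
Qed.

(** As n + k <= (n + 1) * k, the counting inequality follows from b^k < k^k for
    a base [b] that does not depend on k, and k = b + 1 satisfies this. *)
Lemma ramsey_for_spindle_exists r s t n : (0 < s)%N ->
  exists k, ramsey_for (spindle r s t) (boolean_lattice n) (n + k).
Proof.
move=> s_gt0; pose b := (4 * (r + t).+1 ^ n.+1 * s)%N.
exists b.+1; apply: ramsey_for_spindle => //.
rewrite -(ltn_pmul2l (m := 4 ^ b.+1)) ?expn_gt0 //.
apply: leq_trans (exp_self_le_factorial _).
apply: (@leq_ltn_trans (b ^ b.+1)); last by rewrite ltn_exp2r.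
rewrite /b !expnMn mulnA leq_mul2r leq_mul2l -expnM.
by rewrite leq_pexp2l ?orbT // mulSn addnC leq_add2l leq_pmulr.
Qed.

Lemma is_poset_ramsey_exists {d d'} {P : finPOrderType d}
    {Q : finPOrderType d'} {M : nat} : (0 < M)%N -> ramsey_for P Q M ->
  exists N, is_poset_ramsey P Q N.
Proof.
move=> M_gt0 rM; pose good N := (0 < N)%N && `[< ramsey_for P Q N >].
have exM : exists N, good N by exists M; rewrite /good M_gt0; apply/asboolP.
have [N /andP[N_gt0 /asboolP rN] N_min] := ex_minnP exM.
exists N; split=> // M' M'_gt0 rM'; apply: N_min.
by rewrite /good M'_gt0; apply/asboolP.
Qed.

(** * Logarithmic estimates *)

Local Open Scope ring_scope.

Section Logarithms.
Context {R : realType}.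
Implicit Types (x y a : R).

Lemma ln2_gt0 : 0 < ln 2 :> R.
Proof. by rewrite ln_gt0 // ltr1n. Qed.

Lemma ler_log2 {x y} : 0 < x -> x <= y -> log2 x <= log2 y.
Proof.
move=> x_gt0 xy; rewrite ler_pM2r ?invr_gt0 ?ln2_gt0 // ler_ln // posrE //.
exact: lt_le_trans xy.
Qed.

Lemma log2_div x y : 0 < x -> 0 < y -> log2 (x / y) = log2 x - log2 y.
Proof. by move=> x_gt0 y_gt0; rewrite /log2 ln_div // mulrBl. Qed.

(** From ln x = 2 ln (sqrt x) <= 2 sqrt x. *)
Lemma log2_sublinear {delta : R} : 0 < delta ->
  exists M, forall x, M <= x -> log2 x <= delta * x.
Proof.
move=> d_gt0; pose b : R := 2 / (delta * ln 2).
have b_gt0 : 0 < b by rewrite divr_gt0 // mulr_gt0 ?ln2_gt0.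
exists (b ^+ 2) => x b2_le_x.
have x_ge0 : 0 <= x by apply: le_trans b2_le_x; rewrite exprn_ge0 // ltW.
pose a := Num.sqrt x; have xE : x = a ^+ 2 by rewrite sqr_sqrtr.
have le_ba : b <= a.
  by rewrite -(ler_pXn2r (ltn0Sn 1)) ?nnegrE ?sqrtr_ge0 ?(ltW b_gt0) // -xE.
have a_gt0 : 0 < a := lt_le_trans b_gt0 le_ba.
rewrite /log2 xE lnXn // ler_pdivrMr ?ln2_gt0 // mulr2n.
have ln_a : ln a <= a := ltW (ln_sublinear a_gt0).
have : 2 <= a * (delta * ln 2) by rewrite -ler_pdivrMr // mulr_gt0 ?ln2_gt0.
move=> two_le.
have -> : delta * a ^+ 2 * ln 2 = a * (a * (delta * ln 2)) by ring.
apply: (@le_trans _ _ (a * 2)); first by lra.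
by rewrite ler_pM2l.
Qed.

Lemma log2_nat_ge a : exists M, forall x, M <= x -> a <= log2 x.
Proof.
exists (expR (a * ln 2)) => x le_x; rewrite ler_pdivlMr ?ln2_gt0 //.
rewrite -[leLHS]expRK ler_ln // posrE ?expR_gt0 // (lt_le_trans _ le_x) //.
exact: expR_gt0.
Qed.

(** The logarithm of (2^m)^(n + k) * s^k * 4^k < k^k. *)
Lemma lt_factorial_of_log2 (n m s k : nat) : (0 < s)%N -> (0 < k)%N ->
    m%:R * (n%:R + k%:R) + k%:R * log2 (s%:R : R) + 2 * k%:R
      < k%:R * log2 (k%:R : R) ->
  (m.+1 ^ (n + k) * s ^ k < k`!)%N.
Proof.
move=> s_gt0 k_gt0 log_lt.
have : (2 ^ (m * (n + k)) * s ^ k * 4 ^ k < k ^ k)%N.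
  have R4 : (4 : R) = 2 ^+ 2 by rewrite -natrX.
  have pos j : (0 < j)%N -> (j%:R : R) \is Num.pos by rewrite posrE ltr0n.
  rewrite -(ltr_nat R) -ltr_ln;
    try by apply: pos; rewrite ?muln_gt0 ?expn_gt0 ?s_gt0 ?k_gt0.
  rewrite !natrM !natrX R4 -exprM !lnM ?posrE ?mulr_gt0 ?exprn_gt0 ?ltr0n //.
  have lnX (x : R) (j : nat) : 0 < x -> ln (x ^+ j) = j%:R * ln x.
    by move=> x_gt0; rewrite lnXn // mulr_natl.
  rewrite !lnX ?ltr0n //.
  have lnE (j : nat) : ln (j%:R : R) = log2 j%:R * ln 2.
    by rewrite /log2 divfK // gt_eqF // ln2_gt0.
  rewrite (lnE s) (lnE k) !natrM natrD.
  rewrite -(ltr_pM2r ln2_gt0) in log_lt; lra.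
have le_m : (m.+1 ^ (n + k) <= 2 ^ (m * (n + k)))%N.
  by rewrite expnM leq_exp2r ?addn_gt0 ?k_gt0 ?orbT // ltn_expl.
have := exp_self_le_factorial k => le_k lt_k.
rewrite -(ltn_pmul2r (m := 4 ^ k)) ?expn_gt0 // [X in (_ < X)%N]mulnC.
apply: leq_trans le_k; apply: leq_ltn_trans lt_k.
by rewrite leq_mul2r leq_mul2r le_m !orbT.
Qed.

(** The witness is the integer part of (1 + e) * m * n / L.  It exceeds
    (1 + e / 2) * m * n / L, since rounding costs at most (e / 2) * n / L, and
    it is at least n / L, so its logarithm is at least (1 - delta) * L.  The
    value of [delta] makes (1 + e / 2) * (1 - 4 * delta) = 1, where the four
    losses of delta * L are log L, m, log s and 2. *)
Lemma factorial_bound_of_small (e delta : R) (n m s : nat) :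
    let L := log2 (n%:R : R) in
    0 < e -> delta = e / (8 + 4 * e) -> (0 < n)%N -> (0 < m)%N -> (0 < s)%N ->
    1 <= L -> 2 <= delta * L -> m%:R <= delta * L ->
    log2 (s%:R : R) <= delta * L -> log2 L <= delta * L -> L <= e / 2 * n%:R ->
  exists2 k : nat, (m.+1 ^ (n + k) * s ^ k < k`!)%N &
    k%:R <= (1 + e) * m%:R * n%:R / L.
Proof.
move=> L e_gt0 dE n_gt0 m_gt0 s_gt0 L_ge1 two_le m_le s_le LL_le L_le.
have L_gt0 : 0 < L by lra.
pose y : R := n%:R / L; have nE : n%:R = y * L by rewrite divfK // gt_eqF.
have nR_gt0 : 0 < n%:R :> R by rewrite ltr0n.
have y_gt0 : 0 < y by rewrite divr_gt0.
have ey_ge : 1 <= e / 2 * y by rewrite /y mulrA ler_pdivlMr // mul1r.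
have mR_ge1 : 1 <= m%:R :> R by rewrite ler1n.
pose x : R := (1 + e) * m%:R * y.
have x_ge0 : 0 <= x by apply: mulr_ge0 (ltW y_gt0); apply: mulr_ge0 => //; lra.
have /andP[le_kx lt_xk] := truncn_itv x_ge0.
set k := Num.truncn x in le_kx lt_xk; rewrite -natr1 in lt_xk.
have k_gt : (1 + e / 2) * (m%:R * y) < k%:R.
  have : 1 <= e / 2 * (m%:R * y) by nra.
  rewrite /x in lt_xk; nra.
have le_yk : y <= k%:R by nra.
have kR_gt0 : 0 < k%:R :> R by lra.
exists k; last by rewrite -mulrA.
have logk : (1 - delta) * L <= log2 (k%:R : R).
  have := ler_log2 y_gt0 le_yk; rewrite log2_div // -/L; lra.
apply: lt_factorial_of_log2 => //; first by rewrite -(ltr0n R).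
have dE' : (1 + e / 2) * (1 - 4 * delta) = 1 by rewrite dE; field; lra.
have d_lt : 0 < 1 - 4 * delta by nra.
have key : k%:R * ((1 - 4 * delta) * L)
    <= k%:R * (log2 (k%:R : R) - m%:R - log2 (s%:R : R) - 2).
  by rewrite ler_pM2l //; lra.
have : (1 + e / 2) * (m%:R * y) * ((1 - 4 * delta) * L)
    < k%:R * ((1 - 4 * delta) * L) by rewrite ltr_pM2r // mulr_gt0.
have -> : (1 + e / 2) * (m%:R * y) * ((1 - 4 * delta) * L)
    = ((1 + e / 2) * (1 - 4 * delta)) * (m%:R * (y * L)) by ring.
rewrite dE' -nE; lra.
Qed.

End Logarithms.

(** * Asymptotics *)

Local Open Scope classical_set_scope.

Lemma eventually_log2_nat_ge {R : realType} (a : R) :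
  \forall n \near \oo, a <= log2 (n%:R : R).
Proof.
have [M M_le] := log2_nat_ge a.
by near=> n; apply: M_le; near: n; exact: nbhs_infty_ger.
Unshelve. all: by end_near. Qed.

Lemma eventually_factorial_bound (R : realType) (r s t : nat -> nat)
  (hrt : ((r n + t n)%N%:R / Num.sqrt (log2 (n%:R : R)) : R)
    @[n --> \oo] --> (0 : R))
  (hs1 : forall n : nat, (0 < n)%N -> (1 <= s n)%N)
  (hs : (log2 ((s n)%:R : R) / log2 (n%:R : R)) @[n --> \oo] --> (0 : R))
  (e : R) : 0 < e ->
  \forall n \near \oo, (0 < r n + t n)%N ->
    exists2 k : nat,
      ((r n + t n).+1 ^ (n + k) * s n ^ k < k`!)%N &
      k%:R <= (1 + e) * (r n + t n)%N%:R * n%:R / log2 (n%:R : R).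
Proof.
move=> e_gt0; pose delta := e / (8 + 4 * e).
have d_gt0 : 0 < delta by rewrite divr_gt0 //; lra.
have [M M_le] := log2_sublinear d_gt0.
have e2_gt0 : 0 < e / 2 by rewrite divr_gt0.
have [M' M'_le] := log2_sublinear e2_gt0.
near=> n => m_gt0; set L := log2 (n%:R : R).
have n_gt0 : (0 < n)%N by near: n; exact: nbhs_infty_gt.
have L_ge1 : 1 <= L by rewrite /L; near: n; exact: eventually_log2_nat_ge.
have L_gt0 : 0 < L := lt_le_trans ltr01 L_ge1.
apply: (@factorial_bound_of_small R e delta) => //.
- exact: hs1.
- rewrite mulrC -ler_pdivrMr // /L; near: n; exact: eventually_log2_nat_ge.
- have sqrtL_gt0 : 0 < Num.sqrt L by rewrite sqrtr_gt0.
  (* Since 1 <= L, the bound by sqrt L also gives one by L. *)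
  apply: (@le_trans _ _ (delta * Num.sqrt L)).
    rewrite -ler_pdivrMr // -[leLHS]ger0_norm ?divr_ge0 ?sqrtr_ge0 //.
    by rewrite /L; near: n; exact: cvgr0_norm_le.
  rewrite ler_pM2l // -[leRHS]sqr_sqrtr ?(ltW L_gt0) // expr2.
  rewrite ler_peMl ?sqrtr_ge0 //.
  by rewrite -[leLHS]sqrtr1 ler_wsqrtr.
- rewrite -ler_pdivrMr // (le_trans (ler_norm _)) //.
  by rewrite /L; near: n; exact: cvgr0_norm_le.
- by apply: M_le; rewrite /L; near: n; exact: eventually_log2_nat_ge.
- by apply: M'_le; near: n; exact: nbhs_infty_ger.
Unshelve. all: by end_near. Qed.

Theorem theorem2 (R : realType) (r s t : nat -> nat)
  (hrt : ((r n + t n)%N%:R / Num.sqrt (log2 (n%:R : R)) : R) @[n --> \oo] --> (0 : R))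
  (hs1 : forall n : nat, (0 < n)%N -> (1 <= s n)%N)
  (hs : (log2 ((s n)%:R : R) / log2 (n%:R : R)) @[n --> \oo] --> (0 : R)) :
  exists2 eps : nat -> R,
    eps n @[n --> \oo] --> (0 : R) &
    forall n : nat, (2 <= n)%N ->
      (r n + t n = 0 -> s n = 1)%N ->
      exists2 N : nat,
        is_poset_ramsey (spindle (r n) (s n) (t n)) (boolean_lattice n) N &
        N%:R <= n%:R + (1 + eps n) * (r n + t n)%N%:R * n%:R / log2 (n%:R : R).
Proof.
have ramsey_exists n : exists N, (0 < n)%N ->
    is_poset_ramsey (spindle (r n) (s n) (t n)) (boolean_lattice n) N.
  have [n_gt0|n_le0] := ltnP 0 n; last by exists 0%N.
  have [k rk] := ramsey_for_spindle_exists (r n) (s n) (t n) n (hs1 n n_gt0).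
  have nk_gt0 : (0 < n + k)%N by rewrite ltn_addr.
  by have [N rN] := is_poset_ramsey_exists nk_gt0 rk; exists N.
have [N N_ramsey] := choice ramsey_exists.
pose ratio n : R := (N n)%:R - n%:R.
pose main n : R := (r n + t n)%N%:R * n%:R / log2 (n%:R : R).
(* The least nonnegative error for which the bound holds at [n]. *)
pose eps n : R := Num.max 0 (ratio n / main n - 1).
exists eps => [|n n_ge2 point].
  apply/cvgr0Pnorm_le => e e_gt0; near=> n.
  have eps_ge0 : 0 <= eps n by rewrite /eps le_max lexx.
  rewrite ger0_norm // /eps ge_max ltW //= lerBlDr addrC.
  have n_gt0 : (0 < n)%N by near: n; exact: nbhs_infty_gt.
  have L_ge1 : 1 <= log2 (n%:R : R) by near: n; exact: eventually_log2_nat_ge.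
  (* If r + t = 0 the ratio is a division by zero, hence 0. *)
  have [m0|m_gt0] := posnP (r n + t n)%N.
    by rewrite /main m0 !mul0r invr0 mulr0; lra.
  have main_gt0 : 0 < main n.
    apply: divr_gt0 (lt_le_trans ltr01 L_ge1).
    by rewrite mulr_gt0 ?ltr0n.
  have [k fact_k k_le] : exists2 k : nat,
      ((r n + t n).+1 ^ (n + k) * s n ^ k < k`!)%N &
      k%:R <= (1 + e) * (r n + t n)%N%:R * n%:R / log2 (n%:R : R).
    by move: m_gt0; near: n; exact: eventually_factorial_bound.
  have [_ _ N_min] := N_ramsey n n_gt0.
  have nk_gt0 : (0 < n + k)%N by rewrite ltn_addr.
  have := N_min _ nk_gt0 (ramsey_for_spindle _ _ _ _ _ (hs1 n n_gt0) fact_k).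
  rewrite ler_pdivrMr // /main !mulrA => N_le; apply: le_trans k_le.
  by rewrite lerBlDl -natrD ler_nat.
have n_gt0 : (0 < n)%N := ltnW n_ge2.
exists (N n); first exact: N_ramsey.
have L_gt0 : 0 < log2 (n%:R : R) by rewrite divr_gt0 ?ln_gt0 ?ltr1n.
have [m0|m_gt0] := posnP (r n + t n)%N.
  rewrite m0 mulr0 !mul0r addr0 ler_nat.
  have [_ _ N_min] := N_ramsey n n_gt0; apply: N_min => //.
  have /eqP := m0; rewrite addn_eq0 => /andP[/eqP -> /eqP ->].
  by rewrite (point m0); exact: ramsey_for_point.
have main_gt0 : 0 < main n by apply: divr_gt0 L_gt0; rewrite mulr_gt0 ?ltr0n.
rewrite -lerBlDl -/(ratio n) -!mulrA [X in _ * X]mulrA -/(main n).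
by rewrite -ler_pdivrMr // -lerBlDl /eps le_max lexx orbT.
Unshelve. all: by end_near. Qed.
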